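(* Let $G_{\mathrm x}>0$, $G_{\mathrm y}>0$, $R_{\mathcal X}>0$, $R_{\mathcal Y}>0$ be fixed. Then for any generic LMO-PO method (see context) running for $T\ge1$ iterations, there exist dimensions $n,m$ with $T\le\min\{m,n\}/4-1$, compact convex sets $\mathcal X\subseteq\mathbb R^n$ and $\mathcal Y\subseteq\mathbb R^m$ with radii $R_{\mathcal X}$ and $R_{\mathcal Y}$ respectively, and a function $f\in\mathcal F^0_{G_{\mathrm x},G_{\mathrm y},\|\cdot\|_2}(\mathcal X,\mathcal Y)$ (together with initial points $x_1\in\mathcal X$, $y_1\in\mathcal Y$ and a valid tie-breaking rule for the linear minimization oracle) such that the output $(\bar x_T,\bar y_T)$ of the method satisfies $$\max_{y\in\mathcal Y}f(\bar x_T,y)-\min_{x\in\mathcal X}f(x,\bar y_T)\ \ge\ \frac{G_{\mathrm x}R_{\mathcal X}}{2(T+1)^{1/2}}+\frac{G_{\mathrm y}R_{\mathcal Y}}{2(T+1)^{1/2}}.$$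
   Context: For compact convex $\mathcal U$, $\mathrm{LMO}_{\mathcal U}(d)$ returns an element of $\arg\min_{v\in\mathcal U}d^\top v$. A compact convex set $\mathcal U$ has radius $R$ if $\max_{u\in\mathcal U}\|u\|_2=R$. $\mathcal F^0_{G_{\mathrm x},G_{\mathrm y},\|\cdot\|_2}(\mathcal X,\mathcal Y)$ is the class of payoff functions $f:\mathbb R^n\times\mathbb R^m\to\mathbb R$ of saddle-point problems $\min_{x\in\mathcal X}\max_{y\in\mathcal Y}f(x,y)$ that are convex in $x$ and concave in $y$ and satisfy, for all $x,x'\in\mathcal X$ and $y,y'\in\mathcal Y$, $|f(x,y)-f(x',y)|\le G_{\mathrm x}\|x-x'\|_2$ and $|f(x,y)-f(x,y')|\le G_{\mathrm y}\|y-y'\|_2$. Write $f_y(\cdot)=f(\cdot,y)$, $(-f)_x(\cdot)=-f(x,\cdot)$, and $\partial$ for the convex subdifferential. Generic LMO-PO method: given $x_1\in\mathcal X$, $y_1\in\mathcal Y$, for $t=1,\dots,T$ it constructs some (arbitrary) $p_t\in\mathbb R^n$ and sets $x_{t+1}=\mathrm{LMO}_{\mathcal X}(p_t)$; it constructs some points $v_1,\dots,v_t\in\mathbb R^n$ and a map $A_t$ and sets $$y_{t+1}=A_t\Big(\big\{\partial f_{y_i}(v_i),\ \partial(-f)_{v_i}(y_i),\ f(v_i,y_i)\big\}_{1\le i\le t}\Big)\in\mathcal Y .$$ It outputs some $\bar x_T\in\mathrm{conv}(\{x_1,\dots,x_{T+1}\})$ and $\bar y_T=y_{T+1}$. The rules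 by which the method (deterministically) selects the points $v_i$ and the maps $A_t$ are fixed in advance, in all dimensions; they may depend on $\mathcal X,\mathcal Y$, the initial points, the constants and the first-order and value information observed so far, but not otherwise on $f$. Worst-case oracle model: the adversary may choose the feasible sets $\mathcal X,\mathcal Y$, the initial points $x_1,y_1$ (in particular, extreme points), the payoff $f$, and a valid tie-breaking rule for the LMO (in particular, one always returning extreme-point minimizers). *)

(* Defs.v *)
From HB Require Import structures.
From mathcomp Require Import all_boot all_order all_algebra.
From mathcomp Require Import boolp classical_sets reals.
From mathcomp Require Import topology normedtype convex.

Set Implicit Arguments.
Unset Strict Implicit.
Unset Printing Implicit Defensive.

Import Order.TTheory GRing.Theory Num.Theory.
Import numFieldNormedType.Exports.

Local Open Scope classical_set_scope.
Local Open Scope ring_scope.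

Definition dot (R : realType) n (u v : 'rV[R]_n) : R :=
  \sum_(i < n) u 0 i * v 0 i.

(* The library norm on 'rV[R]_n is the sup norm; both norms induce the same
   topology, so [compact] below has its usual meaning. *)
Definition norm2 (R : realType) n (u : 'rV[R]_n) : R := Num.sqrt (dot u u).

Definition is_max (R : realType) (A : set R) (a : R) := A a /\ ubound A a.
Definition is_min (R : realType) (A : set R) (a : R) := A a /\ lbound A a.

Definition has_radius (R : realType) n (U : set 'rV[R]_n) (r : R) :=
  is_max [set norm2 u | u in U] r.

Definition subdiff (R : realType) n (g : 'rV[R]_n -> R) (u : 'rV[R]_n) :
    set 'rV[R]_n :=
  [set s | forall z, g u + dot s (z - u) <= g z].

Definition conv_hull (R : realType) n k (z : 'I_k -> 'rV[R]_n) :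
    set 'rV[R]_n :=
  [set u | exists w : 'I_k -> R,
     [/\ forall i, 0 <= w i, \sum_i w i = 1 & u = \sum_i w i *: z i]].

(* [lmo d] is a minimizer of d^T v over U; the function itself carries the
   tie-breaking rule. *)
Definition is_lmo (R : realType) n (U : set 'rV[R]_n)
    (lmo : 'rV[R]_n -> 'rV[R]_n) :=
  forall d, U (lmo d) /\ forall v, U v -> dot d (lmo d) <= dot d v.

(* Convexity and concavity hold on the whole space, the Lipschitz bounds on the
   feasible sets. *)
Definition saddle_class (R : realType) n m (Gx Gy : R)
    (X : set 'rV[R]_n) (Y : set 'rV[R]_m) (f : 'rV[R]_n -> 'rV[R]_m -> R) :=
  [/\ forall y, convex_function setT (f^~ y),
      forall x, convex_function setT (fun y => - f x y),
      forall x x' y, X x -> X x' -> Y y ->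
        `|f x y - f x' y| <= Gx * norm2 (x - x') &
      forall x y y', X x -> Y y -> Y y' ->
        `|f x y - f x y'| <= Gy * norm2 (y - y')].

Record problem (R : realType) n m := Problem {
  feasX : set 'rV[R]_n;
  feasY : set 'rV[R]_m;
  initX : 'rV[R]_n;
  initY : 'rV[R]_m;
  lmoX : 'rV[R]_n -> 'rV[R]_n
}.

Definition admissible (R : realType) n m (Gx Gy RX RY : R)
    (P : problem R n m) (f : 'rV[R]_n -> 'rV[R]_m -> R) :=
  [/\ [/\ compact (feasX P), convex_set (feasX P) & has_radius (feasX P) RX],
      [/\ compact (feasY P), convex_set (feasY P) & has_radius (feasY P) RY],
      feasX P (initX P) /\ feasY P (initY P),
      is_lmo (feasX P) (lmoX P) &
      saddle_class Gx Gy (feasX P) (feasY P) f].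

Record reply (R : realType) n m := Reply {
  reply_dx : set 'rV[R]_n;
  reply_dy : set 'rV[R]_m;
  reply_val : R
}.

Definition oracle (R : realType) n m (f : 'rV[R]_n -> 'rV[R]_m -> R)
    (v : 'rV[R]_n) (y : 'rV[R]_m) : reply R n m :=
  Reply (subdiff (f^~ y) v) (subdiff (fun y' => - f v y') y) (f v y).

(* The points and the maps see the payoff only through replies: [past] lists the
   replies of the completed iterations (one inner list per iteration), [cur] those
   received so far in the current one, so the indices t and i are the lengths.
   Seeing lmoX, they may also depend on LMO outputs along directions built from
   the replies.  The directions and the averaged output are unrestricted, hence
   arbitrary functions of the whole instance, payoff included. *)
Record rules (R : realType) := Rules {
  direction : forall n m, problem R n m -> ('rV[R]_n -> 'rV[R]_m -> R) ->
    nat -> 'rV[R]_n;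
  point : forall n m, problem R n m -> forall (past : seq (seq (reply R n m)))
    (cur : seq (reply R n m)), 'rV[R]_n;
  ymap : forall n m, problem R n m -> forall past : seq (seq (reply R n m)),
    seq (reply R n m) -> 'rV[R]_m;
  average : forall n m, problem R n m -> ('rV[R]_n -> 'rV[R]_m -> R) ->
    'rV[R]_n
}.

Section Run.
Context (R : realType) (M : rules R) (n m : nat) (P : problem R n m).
Variable f : 'rV[R]_n -> 'rV[R]_m -> R.

(* 0-based: [xiter t] and [yiter t] are the points x_{t+1} and y_{t+1}, and
   [direction t] is p_t. *)
Definition xiter (t : nat) : 'rV[R]_n :=
  if t is 0%N then initX P else lmoX P (direction M P f t).

(* v_1, v_2, ... are produced one after the other, v_i being paired with y_i. *)
Fixpoint query (past : seq (seq (reply R n m))) (ys : seq 'rV[R]_m)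
    (cur : seq (reply R n m)) : seq (reply R n m) :=
  if ys is y :: ys' then
    query past ys' (rcons cur (oracle f (point M P past cur) y))
  else cur.

(* After t iterations: the points y_1, ..., y_{t+1} and the t lists of replies.
   Each iteration chooses its own points v_1, ..., v_t; a method that keeps
   earlier ones merely repeats its queries. *)
Fixpoint trace (t : nat) : seq 'rV[R]_m * seq (seq (reply R n m)) :=
  if t is t'.+1 then
    let: (ys, past) := trace t' in
    let cur := query past ys [::] in
    (rcons ys (ymap M P past cur), rcons past cur)
  else ([:: initY P], [::]).

Definition yiter (t : nat) : 'rV[R]_m := last 0 (trace t).1.

End Run.

Definition lmo_po_method (R : realType) (Gx Gy RX RY : R) (T : nat)
    (M : rules R) :=
  forall n m (P : problem R n m) f, admissible Gx Gy RX RY P f ->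
    (forall t, (t <= T)%N -> feasY P (yiter M P f t)) /\
    conv_hull (fun t : 'I_T.+1 => xiter M P f t) (average M P f).

(* Main.v *)
(** The payoff is separable, f(x,y) = Gx |x| - Gy psi(y), with n = m = 4(T+1).

    On the simplex X with vertices RX e_i, the point x_bar is a combination of
    T+1 vertices, so |x_bar| >= RX / sqrt(T+1), while the center has norm
    RX / (2 sqrt(T+1)).

    On the ball Y, psi is the maximum of - r, r = RY / sqrt(T+1), and of the
    T+1 pieces +-y_i - k delta, 0 <= k <= T, disclosed one at a time: the k-th
    piece uses a coordinate of largest modulus of y_{k+1} among those not used
    before, with the sign that makes it nonnegative there.  At y_{k+1} the later
    pieces involve coordinates of no larger modulus and are lowered more, so they
    are inactive and the replies at y_{k+1} are those of the function disclosed
    so far: the method runs as if psi were fixed in advance.  Hence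
    psi(y_{T+1}) >= - T delta although min psi = - r. *)
Require Import Defs.
From mathcomp Require Import all_boot all_order all_algebra.
From mathcomp Require Import classical_sets reals.
From mathcomp Require Import boolp interval_inference.
From mathcomp Require Import topology normedtype convex.
From mathcomp Require Import zify ring lra.
Import Order.TTheory GRing.Theory Num.Theory.
Import numFieldNormedType.Exports.
Local Open Scope classical_set_scope.
Local Open Scope ring_scope.

Set Implicit Arguments.
Unset Strict Implicit.
Unset Printing Implicit Defensive.

(** * Euclidean inner product and norm *)

Section EuclideanNorm.
Context (R : realType) (n : nat).
Implicit Types (u v w : 'rV[R]_n) (a : R).

Lemma dotC u v : dot u v = dot v u.
Proof. by apply: eq_bigr => i _; rewrite mulrC. Qed.

Lemma dotDl u v w : dot (u + v) w = dot u w + dot v w.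
Proof. by rewrite -big_split; apply: eq_bigr => i _; rewrite mxE mulrDl. Qed.

Lemma dotZl a u w : dot (a *: u) w = a * dot u w.
Proof. by rewrite mulr_sumr; apply: eq_bigr => i _; rewrite mxE mulrA. Qed.

Lemma dotDr u v w : dot w (u + v) = dot w u + dot w v.
Proof. by rewrite dotC dotDl !(dotC w). Qed.

Lemma dotZr a u w : dot w (a *: u) = a * dot w u.
Proof. by rewrite dotC dotZl dotC. Qed.

Lemma dot_ge0 u : 0 <= dot u u.
Proof. by apply: sumr_ge0 => i _; rewrite -expr2 sqr_ge0. Qed.

Lemma norm2_ge0 u : 0 <= norm2 u.
Proof. exact: sqrtr_ge0. Qed.

Lemma sqr_norm2 u : norm2 u ^+ 2 = dot u u.
Proof. by rewrite sqr_sqrtr ?dot_ge0. Qed.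

Lemma norm2Z a u : norm2 (a *: u) = `|a| * norm2 u.
Proof.
by rewrite /norm2 dotZl dotZr mulrA -expr2 sqrtrM ?sqr_ge0 // sqrtr_sqr.
Qed.

Lemma ler_abs_norm2 u i : `|u 0 i| <= norm2 u.
Proof.
rewrite -[leLHS]sqrtr_sqr ler_wsqrtr // /dot (bigD1 i) //= -expr2 lerDl.
by apply: sumr_ge0 => j _; rewrite -expr2 sqr_ge0.
Qed.

(** For [v] nonzero, the squared norm of |v|^2 u - (u.v) v equals |v|^2 (|u|^2 |v|^2 - (u.v)^2), so
    the second factor is nonnegative. *)
Lemma cauchy_schwarz u v : dot u v <= norm2 u * norm2 v.
Proof.
have [v0|v_neq0] := eqVneq (dot v v) 0.
  have vi i : v 0 i = 0.
    apply/eqP; rewrite -normr_le0 (le_trans (ler_abs_norm2 v i)) //.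
    by rewrite /norm2 v0 sqrtr0.
  rewrite /dot big1 ?mulr_ge0 ?norm2_ge0 // => i _; by rewrite vi mulr0.
have v_gt0 : 0 < dot v v by rewrite lt_def v_neq0 dot_ge0.
have := dot_ge0 (dot v v *: u + (- dot u v) *: v).
rewrite !(dotDl, dotDr, dotZl, dotZr) (dotC v u) => h.
have : 0 <= dot v v * (dot u u * dot v v - dot u v ^+ 2) by nra.
rewrite pmulr_rge0 // subr_ge0 => {}h.
rewrite (le_trans (ler_norm _)) // -[leLHS]sqrtr_sqr -sqrtrM ?dot_ge0 //.
exact: ler_wsqrtr.
Qed.

Lemma norm2D u v : norm2 (u + v) <= norm2 u + norm2 v.
Proof.
rewrite -ler_sqr ?nnegrE ?addr_ge0 ?norm2_ge0 //.
rewrite sqr_norm2 !(dotDl, dotDr) sqrrD !sqr_norm2 (dotC v u).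
have := cauchy_schwarz u v; lra.
Qed.

Lemma ler_dist_norm2 u v : `|norm2 u - norm2 v| <= norm2 (u - v).
Proof.
have le_sub u' v' : norm2 u' <= norm2 (u' - v') + norm2 v'.
  by rewrite -{1}(subrK v' u') norm2D.
have := le_sub v u; rewrite -opprB -scaleN1r norm2Z normrN1 mul1r => vu.
rewrite ler_norml; have := le_sub u v; lra.
Qed.

Lemma norm2_const_mx a : norm2 (const_mx a : 'rV[R]_n) = `|a| * Num.sqrt n%:R.
Proof.
have -> : const_mx a = a *: (const_mx 1 : 'rV[R]_n).
  by apply/rowP => i; rewrite !mxE mulr1.
rewrite norm2Z /norm2 /dot (eq_bigr (fun=> 1)) ?sumr_const ?card_ord // => i _.
by rewrite !mxE mulr1.
Qed.

(** Cauchy-Schwarz against the all-ones vector. It serves twice: for the weights of a convex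
    combination, and for the least norm on the simplex. *)
Lemma sum_le_norm2 u : \sum_i u 0 i <= Num.sqrt n%:R * norm2 u.
Proof.
have := cauchy_schwarz (const_mx 1) u.
rewrite norm2_const_mx normr1 mul1r; congr (_ <= _).
by apply: eq_bigr => i _; rewrite mxE mul1r.
Qed.

End EuclideanNorm.

(** * Convex functions and the subdifferential of a maximum *)

Section ConvexFunctions.
Context (R : realType) (n : nat).
Implicit Types (g h : 'rV[R]_n -> R) (u : 'rV[R]_n).

Definition convex_fun g := forall (t : R) x y, 0 <= t <= 1 ->
  g (t *: x + (1 - t) *: y) <= t * g x + (1 - t) * g y.

Lemma convex_fun_convex_function g : convex_fun g -> convex_function setT g.
Proof.
move=> gconv t x y _ _; apply: (gconv t%:num).
by apply/andP; split.
Qed.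

Lemma convex_fun_norm2 : convex_fun (@norm2 R n).
Proof.
move=> t x y /andP[t0 t1]; rewrite (le_trans (norm2D _ _)) // !norm2Z.
by rewrite !ger0_norm // subr_ge0.
Qed.

Lemma convex_fun_affine (a : R) (c : R) g : 0 <= a -> convex_fun g ->
  convex_fun (fun x => a * g x + c).
Proof. by move=> a0 gconv t x y t01; have := gconv t x y t01; nra. Qed.

Lemma convex_fun_max g h : convex_fun g -> convex_fun h ->
  convex_fun (fun x => Num.max (g x) (h x)).
Proof.
move=> gconv hconv t x y t01; have /andP[t0 t1] := t01.
rewrite ge_max; apply/andP; split.
- rewrite (le_trans (gconv _ _ _ t01)) // lerD // ler_wpM2l ?subr_ge0 //;
    by rewrite le_max lexx.
- rewrite (le_trans (hconv _ _ _ t01)) // lerD // ler_wpM2l ?subr_ge0 //;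
    by rewrite le_max lexx orbT.
Qed.

Lemma subdiff_max g h u : convex_fun g -> convex_fun h -> h u < g u ->
  subdiff (fun x => Num.max (g x) (h x)) u = subdiff g u.
Proof.
move=> gconv hconv hgu; apply/seteqP; split => s /= hs z; last first.
  by rewrite (max_l (ltW hgu)) le_max hs.
rewrite leNgt; apply/negP => gz.
(* Otherwise [h] would lie above the line of slope [s] on the whole segment
   from [u] to [z], hence h u >= g u. *)
have key t : 0 < t <= 1 -> g u - h u <= t * (h z - h u - dot s (z - u)).
  move=> /andP[t0 t1]; have t01 : 0 <= t <= 1 by rewrite ltW.
  have := hs (t *: z + (1 - t) *: u).
  have -> : t *: z + (1 - t) *: u - u = t *: (z - u).
    by rewrite scalerBl scale1r scalerBr addrA addrAC addrK.
  rewrite dotZr (max_l (ltW hgu)) le_max => /orP[] h1.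
  - have := gconv t z u t01; nra.
  - have := hconv t z u t01; nra.
set d := h z - h u - dot s (z - u) in key.
have e0 : 0 < g u - h u by lra.
have d0 : 0 < d by have := key 1; rewrite ltr01 lexx mul1r => /(_ isT); lra.
(* This value of [t] turns the right side of [key] into half of the positive gap [g u - h u], a
   contradiction; it is at most 1 because [key 1] bounds the gap by [d]. *)
have := key ((g u - h u) / (2 * d)).
have -> : (g u - h u) / (2 * d) * d = (g u - h u) / 2 by field; lra.
have -> : 0 < (g u - h u) / (2 * d) <= 1.
  rewrite divr_gt0 ?mulr_gt0 //= ler_pdivrMr ?mulr_gt0 // mul1r.
  have := key 1; rewrite ltr01 lexx mul1r => /(_ isT); lra.
by move=> /(_ isT); lra.
Qed.

End ConvexFunctions.

(** * The Euclidean ball and the simplex: compactness, convexity, linear minimization *)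

Section FeasibleSets.
Context (R : realType) (n : nat).
Implicit Types (A : set 'rV[R]_n) (x : 'rV[R]_n) (r : R).

Lemma continuous_dot_diag : continuous (fun x : 'rV[R]_n => dot x x).
Proof.
apply: continuous_big => [|i _]; first exact: add_continuous.
by move=> x; apply: continuousM; exact: coord_continuous.
Qed.

Lemma compact_norm2_closed A r :
  (forall x, A x -> norm2 x <= r) -> closed A -> compact A.
Proof.
move=> Ar Acl.
apply: (@subclosed_compact _ _ [set v : 'rV[R]_n | forall i, v ord0 i \in `[- r, r]]) => //.
  apply: (@rV_compact R n (fun=> `[- r, r]%classic)) => _.
  exact: segment_compact.
move=> x /Ar xr i; rewrite in_itv /= -ler_norml.
exact: le_trans (ler_abs_norm2 x i) xr.
Qed.

Definition ball2 r : set 'rV[R]_n := [set y | norm2 y <= r].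

Lemma compact_ball2 r : 0 <= r -> compact (ball2 r).
Proof.
move=> r0; apply: (@compact_norm2_closed _ r) => //.
have -> : ball2 r = (fun x => dot x x) @^-1` [set a | a <= r ^+ 2].
  by apply/seteqP; split => x /=; rewrite -sqr_norm2 ler_sqr ?nnegrE ?norm2_ge0.
by apply: preimage_closed; [move=> x _; exact: continuous_dot_diag | exact: closed_le].
Qed.

Lemma convex_ball2 r : convex_set (ball2 r).
Proof.
move=> x y t; rewrite !inE /ball2 /= => xr yr.
have t01 : 0 <= t%:num <= 1 by apply/andP; split.
rewrite (le_trans (convex_fun_norm2 x y t01)) //.
by have /andP[] := t01; nra.
Qed.

Definition simplex r : set 'rV[R]_n :=
  [set x | (forall i, 0 <= x 0 i) /\ \sum_i x 0 i = r].

Definition vertex r (i : 'I_n) : 'rV[R]_n := r *: delta_mx 0 i.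

Lemma vertexE r i j : vertex r i 0 j = r * (j == i)%:R.
Proof. by rewrite !mxE eqxx. Qed.

Lemma dot_vertex r i x : dot (vertex r i) x = r * x 0 i.
Proof.
rewrite /dot (bigD1 i) //= vertexE eqxx mulr1 big1 ?addr0 // => j /negPf ji.
by rewrite vertexE ji mulr0 mul0r.
Qed.

Lemma norm2_vertex r i : 0 <= r -> norm2 (vertex r i) = r.
Proof.
by move=> r0; rewrite /norm2 dot_vertex vertexE eqxx mulr1 -expr2 sqrtr_sqr ger0_norm.
Qed.

Lemma simplex_vertex r i : 0 <= r -> simplex r (vertex r i).
Proof.
move=> r0; split=> [j|]; first by rewrite vertexE mulr_ge0.
rewrite (bigD1 i) //= vertexE eqxx mulr1 big1 ?addr0 // => j /negPf ji.
by rewrite vertexE ji mulr0.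
Qed.

Lemma simplex_le r x i : simplex r x -> x 0 i <= r.
Proof. by move=> [x0 <-]; rewrite (bigD1 i) //= lerDl sumr_ge0. Qed.

Lemma norm2_simplex_le r x : 0 <= r -> simplex r x -> norm2 x <= r.
Proof.
move=> r0 rx; rewrite -ler_sqr ?nnegrE ?norm2_ge0 // sqr_norm2 expr2.
have [x0 xr] := rx; rewrite -[in leRHS]xr mulr_sumr; apply: ler_sum => i _.
by rewrite ler_wpM2r // simplex_le.
Qed.

Lemma compact_simplex r : 0 <= r -> compact (simplex r).
Proof.
move=> r0; apply: (@compact_norm2_closed _ r) => [x|]; first exact: norm2_simplex_le.
have -> : simplex r = (fun x => \sum_i x 0 i) @^-1` [set a | a = r] `&`
    \bigcap_(i in setT) ((fun x => x 0 i) @^-1` [set a | 0 <= a]).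
  apply/seteqP; split => x /= [H1 H2]; split => //.
    by move=> i _; exact: H1.
  by move=> i; exact: (H2 i I).
apply: closedI.
  apply: preimage_closed; last exact: closed_eq.
  move=> x _; move: x; apply: continuous_big => [|i _]; first exact: add_continuous.
  exact: coord_continuous.
apply: closed_bigI => i _; apply: preimage_closed; last exact: closed_ge.
by move=> x _; exact: coord_continuous.
Qed.

Lemma convex_simplex r : convex_set (simplex r).
Proof.
move=> x y t; rewrite !inE /simplex /= => -[x0 xr] [y0 yr].
have /andP[t0 t1] : 0 <= t%:num <= 1 by apply/andP; split.
have E i : conv t x y 0 i = t%:num * x 0 i + (1 - t%:num) * y 0 i.
  by rewrite !mxE.
split=> [i|].
  by rewrite E addr_ge0 // mulr_ge0 // subr_ge0.
rewrite (eq_bigr _ (fun i _ => E i)) big_split -!mulr_sumr /= xr yr; ring.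
Qed.

Lemma is_lmo_simplex r (k : 'rV[R]_n -> 'I_n) : 0 <= r ->
  (forall (d : 'rV[R]_n) i, d 0 (k d) <= d 0 i) -> is_lmo (simplex r) (vertex r \o k).
Proof.
move=> r0 kmin d; split=> [|v [v0 <-]]; first exact: simplex_vertex.
rewrite dotC dot_vertex mulr_suml; apply: ler_sum => i _.
by rewrite mulrC ler_wpM2r.
Qed.

(* A convex combination of [k] vertices, repeated or not, satisfies
   |u|^2 >= r^2 |w|^2 since its coordinate at [z t] is at least [r * w t]. *)
Lemma conv_hull_vertices_norm2 r k (z : 'I_k -> 'I_n) (u : 'rV[R]_n) :
  0 <= r -> conv_hull (fun t => vertex r (z t)) u ->
  r <= Num.sqrt k%:R * norm2 u.
Proof.
move=> r0 [w [w0 w1 uE]].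
have uz t : r * w t <= u 0 (z t).
  rewrite uE summxE (bigD1 t) //= mxE vertexE eqxx mulr1 mulrC lerDl.
  by apply: sumr_ge0 => s _; rewrite mxE vertexE !mulr_ge0.
pose W : 'rV[R]_k := \row_t w t.
have le_rW : r * norm2 W <= norm2 u.
  rewrite -ler_sqr ?nnegrE ?mulr_ge0 ?norm2_ge0 // exprMn !sqr_norm2.
  have -> : dot u u = \sum_t w t * (r * u 0 (z t)).
    rewrite [X in dot X _]uE -/(dot _ _).
    rewrite (big_morph (fun v => dot v u) (fun v1 v2 => dotDl v1 v2 u) (_ : dot 0 u = 0)).
      by apply: eq_bigr => t _; rewrite dotZl dot_vertex.
    by rewrite -(scale0r 0) dotZl mul0r.
  rewrite mulr_sumr; apply: ler_sum => t _; rewrite !mxE.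
  have := uz t; have := w0 t; have : 0 <= w t * r by rewrite mulr_ge0.
  by nra.
(* The weights sum to 1, so 1 <= sqrt k |w|. *)
have := sum_le_norm2 W; rewrite (eq_bigr w) ?w1 => [|t _]; last by rewrite mxE.
move=> W1; rewrite -[leLHS]mulr1 (le_trans (ler_wpM2l r0 W1)) //.
by rewrite mulrCA ler_wpM2l ?sqrtr_ge0.
Qed.

End FeasibleSets.

(** * The piecewise linear function psi and its minimizer *)

Section ResistingFunction.
Context (R : realType) (n : nat) (r delta : R).
Implicit Types (h : seq ('I_n.+1 * bool)) (y : 'rV[R]_n.+1).

(* A history lists the signed coordinates disclosed so far, the latest one
   first; the [k]-th one to be disclosed (from 0) is lowered by [k * delta]. *)
Fixpoint resist h y : R :=
  if h is (i, b) :: h' then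
    Num.max (resist h' y) ((-1) ^+ b * y 0 i - (size h')%:R * delta)
  else - r.

Lemma resist_ge h y : - r <= resist h y.
Proof. by elim: h => [|[i b] h IH] //=; rewrite le_max IH. Qed.

Lemma resist_eq h y : 0 <= delta ->
  {in h, forall p : 'I_n.+1 * bool, (-1) ^+ p.2 * y 0 p.1 <= - r} -> resist h y = - r.
Proof.
move=> d0; elim: h => [|[i b] h IH] //= hy.
have hyb : (-1) ^+ b * y 0 i <= - r by apply: (hy (i, b)); rewrite mem_head.
rewrite IH => [|p ph]; last by apply: hy; rewrite in_cons ph orbT.
have dh : 0 <= (size h)%:R * delta by rewrite mulr_ge0.
by rewrite max_l //; lra.
Qed.

Lemma convex_fun_piece (i : 'I_n.+1) (b : bool) (c : R) :
  convex_fun (fun y : 'rV[R]_n.+1 => (-1) ^+ b * y 0 i - c).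
Proof. by move=> t x y _; rewrite !mxE; lra. Qed.

Lemma convex_fun_resist h : convex_fun (resist h).
Proof.
elim: h => [|[i b] h IH] /=; first by move=> t x y _ /=; lra.
by apply: convex_fun_max => //; exact: convex_fun_piece.
Qed.

(** Each piece is a signed coordinate up to a constant, hence 1-Lipschitz, and a maximum keeps this
    bound. *)
Lemma resist_lipschitz h x y : `|resist h x - resist h y| <= norm2 (x - y).
Proof.
elim: h => [|[i b] h IH] /=; first by rewrite subrr normr0 norm2_ge0.
have := ler_abs_norm2 (x - y) i; rewrite !mxE.
set N := norm2 _ in IH *; set a := resist h x in IH *; set a' := resist h y in IH *.
set e := _ * delta; move=> xyi.
have : `|(-1) ^+ b * x 0 i - (-1) ^+ b * y 0 i| <= N.
  by rewrite -mulrBr normrM normrX normrN1 expr1n mul1r.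
rewrite !ler_norml in IH *; set p := _ * x 0 i; set q := _ * y 0 i => pq.
case: (leP a); case: (leP a'); lra.
Qed.

Definition fresh_coord h y : 'I_n.+1 :=
  [arg max_(i > odflt ord0 [pick i | i \notin map fst h] | i \notin map fst h)
     `|y 0 i| ]%O.

Definition disclose h y : 'I_n.+1 * bool :=
  let i := fresh_coord h y in (i, y 0 i < 0).

(** Pigeonhole: at most [n] entries cannot exhaust the [n.+1] coordinates. *)
Lemma fresh_coordP h y : (size h <= n)%N ->
  fresh_coord h y \notin map fst h /\
  forall j, j \notin map fst h -> `|y 0 j| <= `|y 0 (fresh_coord h y)|.
Proof.
move=> hn; rewrite /fresh_coord.
case: pickP => [i0 i0h|all_in] /=.
  by case: arg_maxP => // i ih imax; split=> // j jh; exact: imax.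
have : (n.+1 <= size (map fst h))%N.
  rewrite -[X in (X <= _)%N](card_ord n.+1) cardE.
  apply: uniq_leq_size (enum_uniq _) _ => i _.
  by have := all_in i => /negbFE.
by rewrite size_map ltnNge hn.
Qed.

Lemma sign_disclose h y :
  (-1) ^+ (disclose h y).2 * y 0 (disclose h y).1 = `|y 0 (fresh_coord h y)|.
Proof.
rewrite /disclose /=; case: ltrP => y0; first by rewrite expr1 mulN1r ltr0_norm.
by rewrite expr0 mul1r ger0_norm.
Qed.

Lemma resist_disclose h y :
  `|y 0 (fresh_coord h y)| - (size h)%:R * delta <= resist (disclose h y :: h) y.
Proof. by rewrite -sign_disclose /= le_max lexx orbT. Qed.

(** Each disclosed coordinate is moved by [r] against its sign. When the coordinates are distinct,
    every signed coordinate in [h] equals [- r], so [resist_eq] applies. *)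
Fixpoint minimizer h : 'rV[R]_n.+1 :=
  if h is (i, b) :: h' then minimizer h' + vertex (- (-1) ^+ b * r) i else 0.

Lemma minimizer_notin h i : i \notin map fst h -> minimizer h 0 i = 0.
Proof.
elim: h => [|[j b] h IH] /=; first by rewrite mxE.
rewrite in_cons negb_or => /andP[/negPf ij ih].
by rewrite mxE IH // vertexE ij mulr0 addr0.
Qed.

Lemma minimizer_in h : uniq (map fst h) ->
  {in h, forall p : 'I_n.+1 * bool, (-1) ^+ p.2 * minimizer h 0 p.1 = - r}.
Proof.
elim: h => [|[j b] h IH] //= /andP[jh uh] [i c]; rewrite in_cons => /predU1P[[-> ->]|ich] /=.
  rewrite mxE minimizer_notin // add0r vertexE eqxx mulr1 mulNr mulrN mulrA.
  by rewrite -expr2 sqrr_sign mul1r.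
have ij : (i == j) = false.
  by apply: contraNF jh => /eqP <-; apply/mapP; exists (i, c).
by rewrite mxE vertexE ij mulr0 addr0; exact: (IH uh (i, c) ich).
Qed.

(** Pythagoras: the summands lie on distinct axes. *)
Lemma sqr_norm2_minimizer h : uniq (map fst h) ->
  norm2 (minimizer h) ^+ 2 = (size h)%:R * r ^+ 2.
Proof.
rewrite sqr_norm2; elim: h => [|[i b] h IH] /=.
  by rewrite mul0r -(scale0r 0) dotZl mul0r.
move=> /andP[ih uh]; rewrite !(dotDl, dotDr) IH // dotC !dot_vertex vertexE.
rewrite minimizer_notin // eqxx -natr1.
transitivity ((size h)%:R * r ^+ 2 + ((-1) ^+ b) ^+ 2 * r ^+ 2).
  by rewrite mulr1n; move: (_ ^+ b) => s; ring.
by rewrite sqrr_sign; ring.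
Qed.

End ResistingFunction.

(** * Dependence of a run on the oracle replies alone *)

Section Run.
Context (R : realType) (M : rules R) (n m : nat) (P : problem R n m).
Implicit Types (f : 'rV[R]_n -> 'rV[R]_m -> R).

Lemma trace_points f t : (trace M P f t).1 = mkseq (yiter M P f) t.+1.
Proof.
elim: t => [|t IH] //.
have E : (trace M P f t.+1).1 = rcons (trace M P f t).1 (yiter M P f t.+1).
  by rewrite /yiter /=; case: (trace M P f t) => ys past /=; rewrite last_rcons.
by rewrite E IH -mkseqS.
Qed.

(** [point] and [ymap] receive replies, never the payoff, so equal replies propagate query by query.
    Agreement is asked at every [v] because the query points are chosen adaptively. *)
Lemma trace_eq_step f f' t : trace M P f t = trace M P f' t ->
  (forall s v, (s <= t)%N ->
     oracle f v (yiter M P f s) = oracle f' v (yiter M P f s)) ->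
  trace M P f t.+1 = trace M P f' t.+1.
Proof.
move=> tr_eq or_eq; rewrite /= -tr_eq.
have : {in (trace M P f t).1, forall y v, oracle f v y = oracle f' v y}.
  move=> y; rewrite trace_points => /mapP[s]; rewrite mem_iota => /= st -> v.
  exact: or_eq.
case: (trace M P f t) => ys past /= ys_eq.
suff -> : query M P f past ys [::] = query M P f' past ys [::] by [].
elim: ys [::] ys_eq => [|y ys IH] cur ys_eq //=.
rewrite (ys_eq y) ?mem_head // IH // => z zys.
by apply: ys_eq; rewrite in_cons zys orbT.
Qed.

End Run.

(** * The payoff and its adaptive construction along the run *)

Section Payoff.
Context (R : realType) (n m : nat) (Gx Gy r delta : R).
Hypotheses (Gx0 : 0 < Gx) (Gy0 : 0 < Gy) (delta0 : 0 < delta).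
Implicit Types (h : seq ('I_m.+1 * bool)).

Definition payoff h (x : 'rV[R]_n) (y : 'rV[R]_m.+1) : R :=
  Gx * norm2 x - Gy * resist r delta h y.

Lemma saddle_class_payoff h X Y : saddle_class Gx Gy X Y (payoff h).
Proof.
split=> [y|x|x x' y _ _ _|x y y' _ _ _].
- apply: convex_fun_convex_function.
  exact: convex_fun_affine (ltW Gx0) (@convex_fun_norm2 _ _).
- apply: convex_fun_convex_function.
  have -> : (fun y => - payoff h x y) =
      (fun y => Gy * resist r delta h y + - (Gx * norm2 x)).
    by apply/funext => y; rewrite /payoff opprB.
  exact: convex_fun_affine (ltW Gy0) (@convex_fun_resist _ _ _ _ _).
- rewrite /payoff [X in `|X|](_ : _ = Gx * (norm2 x - norm2 x')); last by ring.
  by rewrite normrM gtr0_norm // ler_pM2l // ler_dist_norm2.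
- rewrite /payoff [X in `|X|](_ : _ =
    - (Gy * (resist r delta h y - resist r delta h y'))); last by ring.
  by rewrite normrN normrM gtr0_norm // ler_pM2l // resist_lipschitz.
Qed.

(** At this [y] the two payoffs agree for all x, which settles the value and the subdifferential in
    x. The one in y also looks at other points; there [subdiff_max] needs the new piece strictly
    below, as a tie could enlarge it. *)
Lemma oracle_payoff_cons h (i : 'I_m.+1) (b : bool) (v : 'rV[R]_n)
    (y : 'rV[R]_m.+1) :
  (-1) ^+ b * y 0 i - (size h)%:R * delta < resist r delta h y ->
  oracle (payoff ((i, b) :: h)) v y = oracle (payoff h) v y.
Proof.
move=> inactive.
have val_eq x : payoff ((i, b) :: h) x y = payoff h x y.
  by rewrite /payoff /= max_l // ltW.
rewrite /oracle val_eq; congr Reply.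
  by congr subdiff; apply/funext.
set c := - (Gx * norm2 v).
have -> : (fun y' => - payoff ((i, b) :: h) v y') = (fun y' =>
    Num.max (Gy * resist r delta h y' + c)
            (Gy * ((-1) ^+ b * y' 0 i - (size h)%:R * delta) + c)).
  apply/funext => y'; rewrite -addr_maxl -maxr_pMr ?ltW //.
  by rewrite /payoff opprB.
have -> : (fun y' => - payoff h v y') = (fun y' => Gy * resist r delta h y' + c).
  by apply/funext => y'; rewrite /payoff opprB.
apply: subdiff_max.
- exact: convex_fun_affine (ltW Gy0) (@convex_fun_resist _ _ _ _ _).
- exact: convex_fun_affine (ltW Gy0) (@convex_fun_piece _ _ _ _ _).
- by rewrite ltrD2r ltr_pM2l.
Qed.

Context (M : rules R) (P : problem R n m.+1).

(** There is no circularity: each piece is read off a run on the payoff made of the earlier pieces.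
    [trace_hist] shows that the run on a later payoff visits the same points. *)
Fixpoint hist (t : nat) : seq ('I_m.+1 * bool) :=
  if t is t'.+1 then
    disclose (hist t') (yiter M P (payoff (hist t')) t') :: hist t'
  else [::].

Definition played (t : nat) : 'rV[R]_m.+1 := yiter M P (payoff (hist t)) t.

Lemma size_hist t : size (hist t) = t.
Proof. by elim: t => //= t ->. Qed.

Lemma uniq_hist t : (t <= m.+1)%N -> uniq (map fst (hist t)).
Proof.
elim: t => //= t IH tm; rewrite IH ?(ltnW tm) // andbT.
by have [] := @fresh_coordP R m (hist t) (played t); rewrite ?size_hist.
Qed.

Lemma resist_hist_mono s t y : (s <= t)%N ->
  resist r delta (hist s) y <= resist r delta (hist t) y.
Proof.
elim: t => [|t IH]; first by rewrite leqn0 => /eqP ->.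
rewrite leq_eqVlt => /predU1P[-> //|/IH le_st].
by rewrite [hist t.+1]/= /disclose [leRHS]/= le_max le_st.
Qed.

Lemma hist_sub s t : (s <= t)%N -> {subset map fst (hist s) <= map fst (hist t)}.
Proof.
elim: t => [|t IH]; first by rewrite leqn0 => /eqP ->.
rewrite leq_eqVlt => /predU1P[-> //|/IH sub_st] i /sub_st it.
by rewrite /= in_cons it orbT.
Qed.

Lemma oracle_hist s t v : (s < t <= m.+1)%N ->
  oracle (payoff (hist t)) v (played s) =
  oracle (payoff (hist s.+1)) v (played s).
Proof.
elim: t => // t IH /andP[]; rewrite ltnS leq_eqVlt => /predU1P[-> //|st] tm.
rewrite -IH ?st ?(ltnW tm) //= oracle_payoff_cons // size_hist.
have ht : (size (hist t) <= m)%N by rewrite size_hist.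
have hs : (size (hist s) <= m)%N by rewrite size_hist (leq_trans (ltnW st)).
have [it _] := fresh_coordP (played t) ht.
have [_ smax] := fresh_coordP (played s) hs.
have {}it := contra (@hist_sub s t (ltnW st) _) it.
apply: (@lt_le_trans _ _ (`|played s 0 (fresh_coord (hist s) (played s))|
    - s%:R * delta)); last first.
  rewrite (le_trans _ (resist_hist_mono (played s) st)) //.
  by have := resist_disclose r delta (hist s) (played s); rewrite size_hist.
(* The moduli may tie; strictness comes from the offsets, [s%:R * delta < t%:R * delta]. *)
apply: ler_ltB; last by rewrite ltr_pM2r // ltr_nat.
rewrite (le_trans _ (smax _ it)) // (le_trans (ler_norm _)) //.
by rewrite normrM normrX normrN1 expr1n mul1r.
Qed.

(** Strong induction on [u]: at each earlier point [played s] both payoffs reply as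
    [payoff (hist s.+1)] does, by [oracle_hist], so [trace_eq_step] extends the agreement. *)
Lemma trace_hist u t : (u <= t <= m.+1)%N ->
  trace M P (payoff (hist t)) u = trace M P (payoff (hist u)) u.
Proof.
have [k] := ubnP u; elim: k u t => // k IH [//|u] t uk /andP[ut tm].
have um : (u.+1 <= m.+1)%N by rewrite (leq_trans ut).
have tr s j : (s <= u)%N -> (s <= j <= m.+1)%N ->
    trace M P (payoff (hist j)) s = trace M P (payoff (hist s)) s.
  by move=> su sj; apply: IH => //; rewrite (leq_ltn_trans su).
apply: trace_eq_step => [|s v su].
  by rewrite !tr // ?leqnSn // ltnW.
have -> : yiter M P (payoff (hist t)) s = played s.
  by rewrite /played /yiter tr // (leq_trans su) // ltnW.
by rewrite !oracle_hist // ?ltnS ?su //= ?(leq_trans su) // (leq_ltn_trans su).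
Qed.

Lemma resist_last T : (T <= m)%N ->
  - (T%:R * delta) <=
  resist r delta (hist T.+1) (yiter M P (payoff (hist T.+1)) T).
Proof.
move=> Tm; have -> : yiter M P (payoff (hist T.+1)) T = played T.
  by rewrite /played /yiter trace_hist // leqnSn.
have := resist_disclose r delta (hist T) (played T); rewrite size_hist.
by apply: le_trans; rewrite lerDr.
Qed.

End Payoff.

Unset Implicit Arguments.

(** * The hard instance and its duality gap *)

Theorem theorem3 (R : realType) (Gx Gy RX RY : R)
    (hGx : 0 < Gx) (hGy : 0 < Gy) (hRX : 0 < RX) (hRY : 0 < RY)
    (T : nat) (hT : (1 <= T)%N)
    (M : rules R) (hM : lmo_po_method Gx Gy RX RY T M) :
  exists (n m : nat) (P : problem R n m) (f : 'rV[R]_n -> 'rV[R]_m -> R),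
    [/\ T%:R <= (minn m n)%:R / 4 - 1 :> R,
        admissible Gx Gy RX RY P f &
        exists maxv minv : R,
          [/\ is_max [set f (average M P f) y | y in feasY P] maxv,
              is_min [set f x (yiter M P f T) | x in feasX P] minv &
              Gx * RX / (2 * Num.sqrt T.+1%:R) + Gy * RY / (2 * Num.sqrt T.+1%:R)
                <= maxv - minv]].
Proof.
(* Both dimensions are [m.+1], that is 4(T+1): the dimension bound holds with equality and the
   square root of the dimension is [2 * S]. *)
pose m := (4 * T + 3)%N; pose S : R := Num.sqrt T.+1%:R.
have S0 : 0 < S by rewrite sqrtr_gt0.
have S2 : S ^+ 2 = T.+1%:R by rewrite sqr_sqrtr.
have m4 : m.+1%:R = (2 * S) ^+ 2 :> R.
  by rewrite exprMn S2 -natrX -natrM /m; congr _%:R; lia.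
have sqrt_m : Num.sqrt m.+1%:R = 2 * S.
  by rewrite m4 sqrtr_sqr gtr0_norm // mulr_gt0.
(* With T+1 pieces, this [r] gives [minimizer] norm exactly [RY]; [delta] keeps the total lowering
   [T%:R * delta] below [r / 2]. *)
pose r := RY / S; pose delta := r / (2 * T.+1%:R).
have r0 : 0 < r by rewrite divr_gt0.
have delta0 : 0 < delta by rewrite divr_gt0 // mulr_gt0.
pose k (d : 'rV[R]_m.+1) : 'I_m.+1 := [arg min_(i < ord0) d 0 i]%O.
pose P := Problem (simplex RX) (@ball2 R m.+1 RY) (vertex RX ord0) 0 (vertex RX \o k).
(* T+1 pieces, since the last one is chosen at the output y_{T+1}. *)
pose h := hist Gx Gy r delta M P T.+1.
pose f := payoff (n := m.+1) Gx Gy r delta h.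
have Padm : admissible Gx Gy RX RY P f.
  split=> /=.
  - split; [exact/compact_simplex/ltW | exact: convex_simplex|split=> /=].
      exists (vertex RX ord0); first exact/simplex_vertex/ltW.
      exact/norm2_vertex/ltW.
    by move=> _ [x xX <-]; apply: norm2_simplex_le => //; exact: ltW.
  - split; [exact/compact_ball2/ltW | exact: convex_ball2|split=> /=].
      exists (vertex RY ord0); last exact/norm2_vertex/ltW.
      by rewrite /ball2 /= norm2_vertex // ltW.
    by move=> _ [y yY <-].
  - split; first exact/simplex_vertex/ltW.
    by rewrite /ball2 /= -(scale0r 0) norm2Z normr0 mul0r ltW.
  - apply: is_lmo_simplex => [|d i]; first exact: ltW.
    by rewrite /k; case: arg_minP => // j _; apply.
  - exact: saddle_class_payoff.
pose z (t : nat) := if t == 0%N then ord0 else k (direction M P f t).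
have xhull : conv_hull (fun t : 'I_T.+1 => vertex RX (z t)) (average M P f).
  have [_ [w [w0 w1 ->]]] := hM _ _ _ _ Padm.
  by exists w; split=> //; apply: eq_bigr => -[[|t] tT] _.
have xbar_ge := conv_hull_vertices_norm2 (ltW hRX) xhull.
rewrite -/S in xbar_ge.
have Tm : (T <= m)%N by rewrite /m; lia.
have ybar_ge : - (T%:R * delta) <= resist r delta h (yiter M P f T).
  exact: resist_last.
have size_h : size h = T.+1 by exact: size_hist.
have uniq_h : uniq (map fst h) by apply: uniq_hist; rewrite // ltnS.
set xbar := average M P f in xbar_ge xhull *.
set ybar := yiter M P f T in ybar_ge *.
exists m.+1, m.+1, P, f; split=> //.
  rewrite minnn (_ : m.+1 = (4 * T.+1)%N); last by rewrite /m; lia.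
  by rewrite natrM mulrC mulKf // -natr1 addrK.
(* The maximum is attained at [minimizer r h], where psi is [- r]; the minimum at the center of the
   simplex, of norm [RX / (2 * S)]. *)
exists (Gx * norm2 xbar + Gy * r),
  (Gx * (RX / (2 * S)) - Gy * resist r delta h ybar); split.
- split=> [|_ [y _ <-]].
    exists (minimizer r h).
      suff : norm2 (minimizer r h) <= RY by [].
      rewrite -ler_sqr ?nnegrE ?norm2_ge0 ?(ltW hRY) //.
      by rewrite sqr_norm2_minimizer // size_h -S2 -exprMn mulrC divfK ?gt_eqF.
    rewrite /f /payoff (resist_eq (ltW delta0)) ?mulrN ?opprK // => p ph.
    by rewrite minimizer_in.
  by rewrite /f /payoff lerD2l lerNl -mulrN ler_pM2l // resist_ge.
- split=> [|_ [x [x0 xRX] <-]].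
    exists (const_mx (RX / m.+1%:R)).
      split=> [i|]; first by rewrite mxE divr_ge0 // ltW.
      rewrite (eq_bigr (fun=> RX / m.+1%:R)) => [|i _]; last by rewrite mxE.
      by rewrite sumr_const card_ord -[_ *+ _]mulr_natr divfK.
    rewrite /f /payoff norm2_const_mx gtr0_norm ?divr_gt0 //.
    rewrite sqrt_m m4; congr (Gx * _ - _); field; lra.
  rewrite /f /payoff lerD2r ler_pM2l // ler_pdivrMr ?mulr_gt0 // mulrC.
  by rewrite -sqrt_m -xRX; exact: sum_le_norm2.
- have xbar_ge' : Gx * (RX / S) <= Gx * norm2 xbar.
    by rewrite ler_pM2l // ler_pdivrMr // mulrC.
  have deltaT : T%:R * delta <= r / 2.
    rewrite /delta mulrA ler_pdivrMr ?mulr_gt0 // [leRHS](_ : _ = r * T.+1%:R).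
      by rewrite mulrC ler_pM2l // ler_nat.
    by field.
  have ybar_ge' : Gy * (- (r / 2)) <= Gy * resist r delta h ybar.
    by rewrite ler_pM2l // (le_trans _ ybar_ge) // lerN2.
  (* In each variable the bound is a full term minus its half: the norm of the center in x, the
     total lowering in y. *)
  have -> : Gx * RX / (2 * S) + Gy * RY / (2 * S) =
      Gx * (RX / S) - Gx * (RX / (2 * S)) + (Gy * r - Gy * (r / 2)).
    by rewrite /r; field; lra.
  by lra.
Qed.
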